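(* Let $q$ be an even prime power and let $n$ be a positive integer with $(n-1)\mid(q-1)$. Then, for every integer $k$ with $k\le\lfloor n/2\rfloor$ and every integer $r$ with $0\le r\le k-1$, there exists a linear code $C$ over $\mathbb{F}_q$ with parameters $[n,k,\ge n-k]_q$ such that $0\le\dim \mathrm{Hull}_E(C)\le k-r$.
   Context: An $[n,k,d]_q$ code is a linear code over $\mathbb{F}_q$ of length $n$, dimension $k$ and minimum Hamming distance $d$; $[n,k,\ge d_0]_q$ means that the minimum distance is at least $d_0$. The Euclidean inner product on $\mathbb{F}_q^n$ is $\langle x,y\rangle_E=\sum_i x_iy_i$, $C^{\perp_E}$ is the dual of $C$ with respect to it, and the Euclidean hull is $\mathrm{Hull}_E(C)=C\cap C^{\perp_E}$. *)

(* Defs.v *)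
From HB Require Import structures.
From mathcomp Require Import all_boot all_order all_algebra.

Set Implicit Arguments.
Unset Strict Implicit.
Unset Printing Implicit Defensive.

Import Order.TTheory GRing.Theory.
Local Open Scope ring_scope.

Definition prime_power (q : nat) : Prop :=
  exists p m : nat, [/\ prime p, (0 < m)%N & q = (p ^ m)%N].

(* A linear code of length n over F is a subspace C : {vspace 'rV[F]_n}. *)

Section HammingDistance.
Variables (F : finFieldType) (n : nat).
Implicit Types (x y : 'rV[F]_n) (C : {vspace 'rV[F]_n}).

Definition hamming_dist x y : nat := #|[set i | x 0 i != y 0 i]|.

(* The neutral value n is harmless when C has two distinct codewords, since
   every distance is at most n; it is a junk value for the zero code. *)
Definition min_dist C : nat :=
  \big[Order.min/n]_(p : 'rV[F]_n * 'rV[F]_n |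
      [&& p.1 \in C, p.2 \in C & p.1 != p.2]) hamming_dist p.1 p.2.

Lemma hamming_dist_le x y : (hamming_dist x y <= n)%N.
Proof. by rewrite -[X in (_ <= X)%N]card_ord max_card. Qed.

Lemma min_dist_geP C d : (d <= n)%N ->
  reflect {in C &, forall x y, x != y -> (d <= hamming_dist x y)%N}
          (d <= min_dist C)%N.
Proof.
move=> le_dn; apply: (iffP idP) => [le_d x y xC yC xy | H].
  have P : [&& (x, y).1 \in C, (x, y).2 \in C & (x, y).1 != (x, y).2].
    by rewrite /= xC yC.
  exact: leq_trans le_d (bigmin_le_cond _ (fun p => hamming_dist p.1 p.2) P).
rewrite -leEnat; apply/bigmin_geP; split=> // -[x y] /= /and3P[xC yC].
exact: H.
Qed.

Lemma min_dist_attained C : (0 < \dim C)%N ->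
  exists x y, [/\ x \in C, y \in C, x != y & hamming_dist x y = min_dist C].
Proof.
rewrite lt0n dimv_eq0 -vpick0 => nz.
pose P (p : 'rV[F]_n * 'rV[F]_n) := [&& p.1 \in C, p.2 \in C & p.1 != p.2].
have P0 : P (vpick C, 0) by rewrite /P /= memv_pick mem0v nz.
have [p _|[x y] /and3P[/= xC yC xy] E] := @eq_bigmin _ _ _ n _ P
  (fun p => hamming_dist p.1 p.2) P0; first exact: hamming_dist_le.
by exists x, y.
Qed.

(* C is an [n, k, >= d0] code. *)
Definition is_code_ge C (k d0 : nat) : Prop :=
  \dim C = k /\ (d0 <= min_dist C)%N.

End HammingDistance.

Section EuclideanHull.
Variables (F : fieldType) (n : nat).
Implicit Types (x y : 'rV[F]_n) (C : {vspace 'rV[F]_n}).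

Definition euclid x y : F := \sum_(i < n) x 0 i * y 0 i.

Fact euclid_linearl y : linear_for *%R (euclid^~ y).
Proof.
move=> a u v; rewrite /euclid mulr_sumr -big_split /=; apply: eq_bigr => i _.
by rewrite !mxE mulrDl mulrA.
Qed.

Fact euclidC x y : euclid x y = euclid y x.
Proof. by apply: eq_bigr => i _; rewrite mulrC. Qed.

Fact euclid_linearr x : linear_for (idfun \; *%R) (euclid x).
Proof. by move=> a u v; rewrite !(euclidC x) euclid_linearl. Qed.

HB.instance Definition _ := bilinear_isBilinear.Build F
  'rV[F]_n 'rV[F]_n F *%R (idfun \; *%R) euclid
  (euclid_linearl, euclid_linearr).

Fact euclid_sym x y : euclid x y = (-1) ^+ false * idfun (euclid y x).
Proof. by rewrite mul1r euclidC. Qed.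

HB.instance Definition _ :=
  isHermitianSesquilinear.Build F 'rV[F]_n false idfun euclid euclid_sym.

Definition dual_code C : {vspace 'rV[F]_n} := orthov euclid C.

Lemma mem_dual_codeP C x :
  reflect {in C, forall y, euclid x y = 0} (x \in dual_code C).
Proof. exact: mem_orthovP. Qed.

Definition hull C : {vspace 'rV[F]_n} := (C :&: dual_code C)%VS.

End EuclideanHull.

(* Main.v *)
(** Put [N = n - 1] and let [w] be a primitive [N]-th root of unity.  The
    evaluations at the [N] powers of [w] of the Laurent polynomials with [k]
    consecutive exponents form an [N, k, N - k + 1] code, and appending a zero
    coordinate gives an [n, k, n - k] code.  As [\sum_(j < N) w ^ (j * e)]
    vanishes unless [N] divides [e], the monomials of exponents [a] and [b] are
    orthogonal unless [a = - b] modulo [N].  Hence if the exponents are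
    [- s, ..., k - 1 - s] with [s = k./2], every monomial except possibly the
    first one has a partner, and the hull has dimension at most [1]. *)
Require Import Defs.
From mathcomp Require Import all_boot all_order all_algebra.
From mathcomp Require Import cyclic finfield zify.

Set Implicit Arguments.
Unset Strict Implicit.
Unset Printing Implicit Defensive.

Import GRing.Theory.
Local Open Scope ring_scope.

(** All [#|F|.-1] nonzero elements are roots of unity of that exponent, so one of them is primitive;
    a suitable power of it has order [N]. *)
Lemma finField_prim_root (F : finFieldType) (N : nat) :
  (N %| #|F|.-1)%N -> exists w : F, N.-primitive_root w.
Proof.
have F_gt1 := finNzRing_gt1 F.
have q_gt0 : (0 < #|F|.-1)%N by rewrite -ltnS prednK // ltnW.
pose rs := enum [set x : F | x != 0].
have /(has_prim_root q_gt0) H : all #|F|.-1.-unity_root rs.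
  apply/allP=> x; rewrite mem_enum inE => x_nz; apply/unity_rootP.
  by apply: (mulfI x_nz); rewrite -exprS mulr1 prednK ?expf_card // ltnW.
have /hasP[w _ prim_w] : has #|F|.-1.-primitive_root rs.
  apply: H; rewrite ?enum_uniq // -cardE.
  have -> : [set x : F | x != 0] = [set~ 0] by apply/setP=> x; rewrite !inE.
  by rewrite cardsC1.
by move=> N_dvd; exists (w ^+ (#|F|.-1 %/ N)); apply: (dvdn_prim_root prim_w).
Qed.

Lemma sum_prim_root (F : fieldType) (N e : nat) (w : F) :
  N.-primitive_root w ->
  \sum_(j < N) (w ^+ j) ^+ e = if (N %| e)%N then N%:R else 0.
Proof.
move=> prim_w; under eq_bigr do rewrite exprAC.
rewrite (prim_order_dvd prim_w); case: eqP => [->|/eqP we_neq1].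
  by under eq_bigr do rewrite expr1n; rewrite sumr_const card_ord.
(* The sum is geometric of ratio [w ^+ e], and [(w ^+ e) ^+ N = 1]. *)
have : (w ^+ e - 1) * (\sum_(j < N) (w ^+ e) ^+ j) = 0.
  by rewrite -subrX1 exprAC (prim_expr_order prim_w) expr1n subrr.
by move/eqP; rewrite mulf_eq0 subr_eq0 (negPf we_neq1) => /eqP.
Qed.

Section ExtendedCode.
Variables (F : finFieldType) (N k t : nat) (w : F).
Hypothesis prim_w : N.-primitive_root w.

(* Exponents matter modulo [N] only: [t = N - s] encodes a shift by [- s]. *)
Definition gen_mx : 'M[F]_(k, N.+1) :=
  \matrix_(i, j) ((j < N)%:R * (w ^+ j) ^+ (i + t)).

Definition code : {vspace 'rV[F]_N.+1} := limg (linfun (mulmxr gen_mx)).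

Lemma codeP x : reflect (exists c, x = c *m gen_mx) (x \in code).
Proof.
apply: (iffP memv_imgP) => [[c _ ->]|[c ->]]; exists c; rewrite ?memvf //;
  by rewrite lfunE.
Qed.

Lemma gen_mx_eval (c : 'rV_k) (j : 'I_N.+1) : (j < N)%N ->
  (c *m gen_mx) 0 j = (rVpoly c).[w ^+ j] * (w ^+ j) ^+ t.
Proof.
move=> j_lt; rewrite (@horner_coef_wide _ k) ?size_poly // mulr_suml !mxE.
by apply: eq_bigr => i _; rewrite !mxE j_lt mul1r exprD mulrA coef_rVpoly_ord.
Qed.

(** Zeros outside the last coordinate sit at distinct roots of a nonzero polynomial of size at most
    [k], so there are fewer than [k] of them; the last coordinate adds at most one. *)
Lemma gen_mx_weight (c : 'rV_k) : c != 0 ->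
  (N.+1 - k <= #|[set j | (c *m gen_mx) 0 j != 0]%R|)%N.
Proof.
move=> c_nz; set S := [set j | _].
have p_nz : rVpoly c != 0.
  by apply: contraNneq c_nz => p0; rewrite -[c]rVpolyK p0 linear0.
have w_nz : w != 0.
  by rewrite (prim_root_eq0 prim_w) -lt0n (prim_order_gt0 prim_w).
have Z_lt (j : 'I_N.+1) : j \in ~: S :\ ord_max -> (j < N)%N.
  by rewrite !inE -(inj_eq val_inj) /= => /andP[]; have := ltn_ord j; lia.
have le_roots : (#|~: S :\ ord_max| < size (rVpoly c))%N.
  rewrite cardE -(size_map (fun j : 'I_N.+1 => w ^+ j)).
  apply: max_poly_roots => //.
    apply/allP=> _ /mapP[j + ->]; rewrite mem_enum => jZ; have := jZ.
    rewrite !inE negbK gen_mx_eval ?Z_lt // mulf_eq0 !expf_eq0 (negPf w_nz).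
    by rewrite !andbF orbF => /andP[].
  rewrite map_inj_in_uniq ?enum_uniq // => i j; rewrite !mem_enum => iZ jZ /eqP.
  rewrite (eq_prim_root_expr prim_w) !modn_small ?Z_lt // => /eqP.
  exact: val_inj.
have le_k : (size (rVpoly c) <= k)%N := size_poly _ _.
have := cardsC S; rewrite card_ord (cardsD1 ord_max (~: S)).
by case: (_ \in _); lia.
Qed.

Lemma code_parameters : (k <= N)%N -> is_code_ge code k (N.+1 - k).
Proof.
move=> k_le; split.
  rewrite limg_dim_eq ?dimvf /dim /= ?mul1n //.
  apply/eqP; rewrite capfv -subv0; apply/subvP=> c.
  (* A nonzero [c] in the kernel would give a word of weight 0, below the bound [N.+1 - k > 0]. *)
  rewrite memv_ker memv0 lfunE /= => /eqP c0; apply: contraTT k_le => c_nz.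
  have := gen_mx_weight c_nz; rewrite c0 (_ : [set _ | _] = set0).
    by rewrite cards0; lia.
  by apply/setP=> j; rewrite !inE mxE eqxx.
apply/min_dist_geP; first exact: leq_subr.
move=> _ _ /codeP[c ->] /codeP[d ->] neq.
have /gen_mx_weight le_wt : c - d != 0.
  by apply: contraNneq neq => /subr0_eq ->.
apply: leq_trans le_wt _; apply/subset_leq_card/subsetP=> j.
by rewrite !inE mulmxBl !mxE subr_eq0.
Qed.

Lemma euclid_row (c : 'rV_k) (i : 'I_k) :
  euclid (c *m gen_mx) (row i gen_mx) =
  \sum_(l < k) c 0 l * (if (N %| (l + t) + (i + t))%N then N%:R else 0).
Proof.
rewrite /euclid big_ord_recr /= !mxE ltnn mul0r mulr0 addr0.
under [RHS]eq_bigr do rewrite -(sum_prim_root _ prim_w) mulr_sumr.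
rewrite exchange_big /=; apply: eq_bigr => j _; rewrite !mxE mulr_suml.
by apply: eq_bigr => l _; rewrite !mxE /= ltn_ord !mul1r -mulrA -exprD.
Qed.

End ExtendedCode.

Lemma hull_code_le1 (F : finFieldType) (N k : nat) (w : F) :
  N.-primitive_root w -> (0 < k <= N)%N ->
  (\dim (hull (code N k (N - k./2) w)) <= 1)%N.
Proof.
case: k => // k prim_w k_le; set t := (N - _)%N.
pose g := row ord0 (gen_mx N k.+1 t w).
suff sub : (hull (code N k.+1 t w) <= <[g]>)%VS.
  by apply: leq_trans (dimvS sub) _; rewrite dim_vline leq_b1.
apply/subvP=> x; rewrite memv_cap => /andP[/codeP[c ->]].
move/mem_dual_codeP=> c_orth; apply/vlineP; exists (c 0 ord0).
suff c_tail i : i != ord0 -> c 0 i = 0.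
  rewrite mulmx_sum_row (bigD1 ord0) //= big1 ?addr0 // => i i_nz.
  by rewrite c_tail ?scale0r.
rewrite -val_eqE /= => i_nz; have i_lt := ltn_ord i.
(* With [s = k.+1./2], the partner of row [i] is row [2s - i]: their exponents add up to [2N]. The
   index is in range because [i > 0]. *)
have i'_lt : (k.+1./2.*2 - i < k.+1)%N by lia.
have := c_orth (row (Ordinal i'_lt) (gen_mx N k.+1 t w)).
rewrite euclid_row //= (bigD1 i) //= big1 => [|l l_neq].
  rewrite (_ : (N %| _)%N); last by apply/dvdnP; exists 2; rewrite /t; lia.
  rewrite addr0 => ci_eq0; apply: (mulIf (prim_root_natf_neq0 prim_w)).
  rewrite mul0r ci_eq0 //; apply/codeP.
  by exists (delta_mx 0 (Ordinal i'_lt)); rewrite rowE.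
(* For [l != i] the exponent sum is [2N + l - i] with [0 < |l - i| < N]. *)
rewrite (_ : (N %| _)%N = false) ?mulr0 //.
move: l_neq; rewrite -val_eqE /= => l_neq; have l_lt := ltn_ord l.
by apply/negP=> /dvdnP[[|[|[|m]]]]; rewrite /t; nia.
Qed.

Theorem theorem1 (q : nat) (hq : prime_power q) (hq_even : ~~ odd q)
    (F : finFieldType) (hF : #|F| = q)
    (n : nat) (hn : (0 < n)%N) (hdvd : (n - 1 %| q - 1)%N) :
  forall k : nat, (k <= n %/ 2)%N ->
  forall r : nat, (r < k)%N ->
  exists C : {vspace 'rV[F]_n},
    is_code_ge C k (n - k) /\ (0 <= \dim (hull C) <= k - r)%N.
Proof.
case: n hn hdvd => // N _; rewrite !subn1 /= -hF => N_dvd k k_le r r_lt.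
have [w prim_w] := finField_prim_root N_dvd.
have k_leN : (k <= N)%N by lia.
exists (code N k (N - k./2) w); split; first exact: code_parameters.
(* From [r < k] follow [0 < k] and [1 <= k - r]. *)
apply: leq_trans (hull_code_le1 prim_w _) _; lia.
Qed.
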